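(* Let $X$ be a real strictly convex normed linear space of dimension $2$ and let $e_1, e_2 \in S_X$. Then the diameters of $S_X$ through $e_1$ and $e_2$ are a pair of conjugate diameters if and only if $\{e_1, e_2\}$ is a strongly orthonormal Hamel basis in the sense of Birkhoff-James.
   Context: $S_X = \{x \in X : \|x\| = 1\}$ and $B_X = \{x \in X : \|x\| \le 1\}$. $X$ is strictly convex iff every element of $S_X$ is an extreme point of $B_X$. $x \perp_B y$ (Birkhoff-James orthogonality) iff $\|x\| \le \|x + \lambda y\|$ for all scalars $\lambda$. For a two-dimensional real normed space $X$, two diameters of $S_X$ passing through $x \in S_X$ and $y \in S_X$ are said to be conjugate iff $x \perp_B y$ and $y \perp_B x$. The set $\{e_1, e_2\}$ is a strongly orthonormal Hamel basis in the sense of Birkhoff-James iff it is a Hamel basis of $X$, $\|e_1\| = \|e_2\| = 1$, and $\|e_1\| < \|e_1 + \lambda e_2\|$ and $\|e_2\| < \|e_2 + \lambda e_1\|$ for all scalars $\lambda \ne 0$. *)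

(* Defs.v *)
From HB Require Import structures.
From mathcomp Require Import all_boot all_order all_algebra.
From mathcomp Require Import all_classical all_reals all_analysis.
Import Order.TTheory GRing.Theory Num.Theory.
Import numFieldNormedType.Exports.

Set Implicit Arguments.
Unset Strict Implicit.
Unset Printing Implicit Defensive.

Local Open Scope classical_set_scope.
Local Open Scope ring_scope.

(* Finite-dimensional normed spaces: the vectType structure makes [\dim] and
   [basis_of] available; the norm remains arbitrary. *)
#[short(type="normedVectType")]
HB.structure Definition NormedVect (R : numFieldType) :=
  {V of Vector R V & NormedModule R V}.

Section NormedSpace.
Context {R : realType} {X : normedModType R}.
Implicit Types (x y : X) (A : set X).

Definition unit_sphere : set X := [set x | `|x| = 1].

Definition unit_ball : set X := [set x | `|x| <= 1].

Definition extreme_point A x : Prop :=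
  A x /\ forall (a b : X) (t : R), A a -> A b -> 0 < t < 1 ->
    x = t *: a + (1 - t) *: b -> a = x /\ b = x.

Definition BJ_orthogonal x y : Prop :=
  forall lambda : R, `|x| <= `|x + lambda *: y|.

(* A diameter of the unit sphere is given by a point [x] of the sphere through
   which it passes; its endpoints are [x] and [- x], and the relation below does
   not depend on the choice between them. *)
Definition conjugate_diameters x y : Prop :=
  BJ_orthogonal x y /\ BJ_orthogonal y x.

End NormedSpace.

Definition strictly_convex (R : realType) (X : normedModType R) : Prop :=
  forall x : X, unit_sphere x -> extreme_point unit_ball x.

Definition BJ_strongly_orthonormal_basis (R : realType) (X : normedVectType R)
    (e1 e2 : X) : Prop :=
  [/\ basis_of fullv [:: e1; e2],
      `|e1| = 1, `|e2| = 1,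
      forall lambda : R, lambda != 0 -> `|e1| < `|e1 + lambda *: e2|
    & forall lambda : R, lambda != 0 -> `|e2| < `|e2 + lambda *: e1| ].

(* Main.v *)
Require Import Defs.
From mathcomp Require Import all_boot all_order all_algebra.
From mathcomp Require Import all_classical all_reals all_analysis.
Import Order.TTheory GRing.Theory Num.Theory.

Local Open Scope ring_scope.

(** Strict convexity upgrades orthogonality to its strict form ([BJ_orthogonal_strict]): a failure
    of strictness would put a nondegenerate segment on the unit sphere. Orthogonality of nonzero
    vectors also excludes linear dependence ([BJ_orthogonal_free]), so in dimension 2 the pair is a
    basis. Conversely, strict inequalities for nonzero scalars weaken to orthogonality, the zero
    scalar giving equality. *)

(* If [|x + l *: y| <= |x|] with [l != 0], the midpoint of [x] and [x + l *: y]
   lies on the sphere and is not extreme. *)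
Lemma BJ_orthogonal_strict (R : realType) (X : normedModType R) (x y : X) :
  strictly_convex X -> unit_sphere x -> y != 0 -> BJ_orthogonal x y ->
  forall l : R, l != 0 -> `|x| < `|x + l *: y|.
Proof.
move=> scX x1 y0 xy l l0; rewrite real_ltNge ?normr_real//; apply/negP => le_x.
have mid : x + (2^-1 * l) *: y = 2^-1 *: x + (1 - 2^-1) *: (x + l *: y).
  have -> : 1 - 2^-1 = 2^-1 :> R by rewrite {1}(splitr 1) mul1r addrK.
  by rewrite scalerDr addrA -scalerDl scalerA -{2 3}[2^-1]mul1r -splitr scale1r.
have Bx : unit_ball x by rewrite /unit_ball /= x1.
have Bxy : unit_ball (x + l *: y) by rewrite /unit_ball /= -x1.
have half01 : 0 < (2^-1 : R) < 1 by rewrite invr_gt0 ltr0n invf_lt1 ?ltr0n ?ltr1n.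
(* Orthogonality at the scalar [2^-1 * l] bounds the norm below by 1; the triangle inequality on the
   convex combination [mid] bounds it above. *)
have Sm : unit_sphere (x + (2^-1 * l) *: y).
  apply/eqP; rewrite eq_le; apply/andP; split; last first.
    by rewrite -[leLHS]x1; exact: xy.
  rewrite mid.
  apply: le_trans (ler_normD _ _) _; rewrite !normrZ.
  have /andP[h0 h1] := half01.
  rewrite !ger0_norm ?subr_ge0 ?(ltW h0) ?(ltW h1)// x1 mulr1.
  by rewrite -lerBrDl ler_piMr ?subr_ge0 ?(ltW h1).
(* Extremality forces the midpoint to equal its endpoint [x], so [(2^-1 * l) *: y] vanishes, against
   [l0] and [y0]. *)
have [_ /(_ _ _ _ Bx Bxy half01 mid)[/esym/eqP]] := scX _ Sm.
rewrite -subr_eq0 addrAC subrr add0r scaler_eq0 (negPf y0) orbF.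
by rewrite mulf_eq0 invr_eq0 pnatr_eq0 (negPf l0).
Qed.

(** If [x = c *: y], orthogonality at the scalar [- c] gives [|x| <= 0]. *)
Lemma BJ_orthogonal_free (R : realType) (X : normedVectType R) (x y : X) :
  x != 0 -> y != 0 -> BJ_orthogonal x y -> free [:: x; y].
Proof.
move=> x0 y0 xy; rewrite free_cons seq1_free y0 andbT span_seq1.
apply/negP => /vlineP[c xE]; have := xy (- c).
by rewrite scaleNr -xE subrr normr0 normr_le0 (negPf x0).
Qed.

Lemma strict_BJ_orthogonal (R : realType) (X : normedModType R) (x y : X) :
  (forall l : R, l != 0 -> `|x| < `|x + l *: y|) -> BJ_orthogonal x y.
Proof.
move=> xy l; have [->|/xy/ltW//] := eqVneq l 0.
by rewrite scale0r addr0.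
Qed.

Theorem theorem4p1 (R : realType) (X : normedVectType R)
    (dimX : \dim {:X} = 2%N) (scX : strictly_convex X)
    (e1 e2 : X) (he1 : unit_sphere e1) (he2 : unit_sphere e2) :
  conjugate_diameters e1 e2 <-> BJ_strongly_orthonormal_basis e1 e2.
Proof.
have sphere_neq0 (x : X) : unit_sphere x -> x != 0.
  by move=> x1; rewrite -normr_eq0 x1 oner_eq0.
split=> [[e12 e21]|[_ _ _ e12 e21]]; last first.
  by split; apply: strict_BJ_orthogonal.
split=> //; [|exact: BJ_orthogonal_strict (sphere_neq0 _ he2) e12
             |exact: BJ_orthogonal_strict (sphere_neq0 _ he1) e21].
by rewrite basisEfree BJ_orthogonal_free ?sphere_neq0// subvf dimX.
Qed.
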